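(* There exists a set $R\subseteq\mathbb{N}$ which is a set of strong recurrence but not a van der Corput set.
   Context: $\mathbb{N}=\{1,2,3,\dots\}$ (zero excluded), $\mathbb{T}=\mathbb{R}/\mathbb{Z}$, and all measures on $\mathbb{T}$ are Borel measures. A measure preserving system $(X,\mathcal{A},\mu,T)$ consists of a probability space $(X,\mathcal{A},\mu)$ and a measurable map $T:X\to X$ with $\mu(T^{-1}A)=\mu(A)$ for all $A\in\mathcal{A}$. Set of strong recurrence: an infinite set $D\subseteq\mathbb{N}$ such that for every measure preserving system $(X,\mathcal{A},\mu,T)$ and every $A\in\mathcal{A}$ with $\mu(A)>0$ one has $\limsup_{m\to\infty,\ m\in D}\mu(A\cap T^{-m}A)>0$. Van der Corput (vdC) set: a set $D\subseteq\mathbb{N}$ such that whenever $\sigma$ is a non-negative finite measure on $\mathbb{T}$ with $\widehat{\sigma}(h):=\int_{\mathbb{T}}e^{-2\pi i h t}\,d\sigma(t)=0$ for every $h\in D$, then $\sigma$ is continuous, i.e. $\sigma(\{t\})=0$ for every $t\in\mathbb{T}$. *)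

(* Defs.v *)
From HB Require Import structures.
From mathcomp Require Import all_boot all_order all_algebra.
From mathcomp Require Import all_classical all_reals all_analysis.
From mathcomp Require Import complex.

Set Implicit Arguments.
Unset Strict Implicit.
Unset Printing Implicit Defensive.
Import Order.TTheory GRing.Theory Num.Theory.
Import numFieldNormedType.Exports.

Local Open Scope classical_set_scope.
Local Open Scope ring_scope.

Definition measure_preserving (R : realType) (d : measure_display)
    (X : measurableType d) (mu : probability X R) (T : X -> X) : Prop :=
  measurable_fun [set: X] T /\
  forall A : set X, measurable A -> mu (T @^-1` A) = mu A.

(* The filter [within D \oo] is generated by the sets {m in D | m >= N}, so the
   limes superior is taken as m tends to infinity inside D. *)
Definition strong_recurrence_set (R : realType) (D : set nat) : Prop :=
  [/\ D `<=` [set n | (0 < n)%N],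
      infinite_set D &
      forall (d : measure_display) (X : measurableType d)
             (mu : probability X R) (T : X -> X),
        measure_preserving mu T ->
        forall A : set X, measurable A -> (0 < mu A)%E ->
          (0 < limf_esup (fun m : nat => mu (A `&` iter m T @^-1` A))
                         (within D \oo))%E].

(* R / Z with the quotient topology; [Num.int_num_subdef] is the predicate
   underlying the qualifier [Num.int]. *)
Definition int_subgroup (R : realType) : zmodClosed R :=
  GRing.ZmodClosed.clone R (@Num.int_num_subdef R) _.

Definition torus (R : realType) : Type :=
  quotient_topology (Quotient.quot (int_subgroup R)).

HB.instance Definition _ (R : realType) := Quotient.on (torus R).
HB.instance Definition _ (R : realType) := PointedTopological.on (torus R).

Lemma torus_eqP (R : realType) (x y : R) :
  (x = y %[mod torus R])%qT <-> x - y \is a Num.int.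
Proof.
have -> : (x - y \is a Num.int) =
          (x == y %[mod Quotient.quot (int_subgroup R)])%qT.
  by rewrite -Quotient.idealrBE.
by split=> [xy|/eqP xy]; [apply/eqP; exact: xy|exact: xy].
Qed.

Definition borel_torus (R : realType) :=
  g_sigma_algebraType (@open (torus R)).

HB.instance Definition _ (R : realType) := Measurable.on (borel_torus R).

Definition complex_integral (R : realType) (d : measure_display)
    (X : measurableType d) (mu : {measure set X -> \bar R}) (f : X -> R[i]) :
    R[i] :=
  (Rintegral mu setT (fun x => complex.Re (f x)) +i*
   Rintegral mu setT (fun x => complex.Im (f x)))%C.

Definition cexpi (R : realType) (x : R) : R[i] := (cos x +i* sin x)%C.

(* The integrand is 1-periodic, so it does not depend on the representative
   [repr t] of [t]. *)
Definition fourier_coef (R : realType)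
    (sigma : {measure set (borel_torus R) -> \bar R}) (h : nat) : R[i] :=
  complex_integral sigma
    (fun t : borel_torus R =>
       cexpi (- (2 * pi * h%:R * (repr (t : torus R) : R)))).

Definition vdC_set (R : realType) (D : set nat) : Prop :=
  D `<=` [set n | (0 < n)%N] /\
  forall sigma : {finite_measure set (borel_torus R) -> \bar R},
    (forall h : nat, D h -> fourier_coef sigma h = 0) ->
    forall t : borel_torus R, sigma [set t] = 0%E.

(* Main.v *)
Require Import Defs.
From HB Require Import structures.
From mathcomp Require Import all_boot all_order all_algebra all_field.
From mathcomp Require Import zify ring lra.

(** The set is a union of finite blocks.  A block carries an odd prime [p] and
    [3 * p] lacunary powers of two [M_i]; its elements are the positive
    differences [h] of the sums of the [M_i] over two index sets [X], [Y] that
    differ in exactly [2 * p] places.  Each prime of an unbounded list is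
    carried by infinitely many blocks.

    Strong recurrence.  Fix [T] and [A] with [mu A > 0], and let [G x] be the
    family of index sets [X] such that [T], iterated as many times as the sum of
    the [M_i] over [X], sends [x] into [A].  On average over [x], [G x] has
    density [mu A] in the cube of all index sets.  The polynomial method of
    Frankl and Wilson ([frankl_wilson]) shows that a family of more than
    exponentially small density contains [X], [Y] at Hamming distance exactly
    [2 * p], so that the orbit of [x] visits [A] at two times whose difference is
    an element [h] of the block.  Integrating over [x] ([cube_pigeonhole]), some
    [h] in the block satisfies [mu (A `&` T^-h A) > c], with [c] depending only
    on [mu A] and [p], not on the block.  Since [p] recurs in infinitely many
    blocks, the limes superior is at least [c].

    Failure of the van der Corput property.  Pick an index [i] uniformly in each
    block and let [theta] be the sum of the numbers [1 / (2 * M_i)] over all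
    blocks.  Modulo [1], and up to a tiny error, only the summand of the block of
    [h] matters in [h * theta]: it is [1/2] if [i] lies in exactly one of [X] and
    [Y], and [0] otherwise.  As [X] and [Y] differ in two thirds of the places,
    the mean of [cos (2 pi h theta)] is close to [1/3 - 2/3 = -1/3]
    ([block_coefficient]).  This value is the same for all [h], which is the
    reason for fixing the distance of [X] and [Y] exactly.  So the measure
    [delta_0 + 3 * law(theta)] has an atom and cosine coefficients that are
    summable over the set ([summable_coefficients]).  A measure with density an
    absolutely convergent cosine series makes them all vanish
    ([ex_cosine_correction]), and symmetrizing removes the sine coefficients
    ([not_vdC_criterion]). *)

Set Implicit Arguments.
Unset Strict Implicit.
Unset Printing Implicit Defensive.
Import Order.TTheory GRing.Theory Num.Theory.
Local Open Scope ring_scope.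

(** * Families of sets avoiding a Hamming distance *)

Definition sdist (I : finType) (X Y : {set I}) : nat :=
  (#|X :\: Y| + #|Y :\: X|)%N.

(** A set [Y] is a point of the cube, and the monomial of the variables indexed by
    [S] takes there the value [S \subset Y]; so these are the multilinear
    polynomials of degree at most [d], seen as functions on the cube. *)
Definition lowdeg (I : finType) (K : fieldType) (d : nat) (f : {set I} -> K) :=
  exists c : {set I} -> K,
    forall Y, f Y = \sum_(S : {set I} | (#|S| <= d)%N) c S * (S \subset Y)%:R.

Lemma lowdegD (I : finType) (K : fieldType) d (f g : {set I} -> K) :
  lowdeg d f -> lowdeg d g -> lowdeg d (fun Y => f Y + g Y).
Proof.
move=> [c fE] [e gE]; exists (fun S => c S + e S) => Y.
by rewrite fE gE -big_split; apply: eq_bigr => S _; rewrite mulrDl.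
Qed.

Lemma lowdegZ (I : finType) (K : fieldType) d a (f : {set I} -> K) :
  lowdeg d f -> lowdeg d (fun Y => a * f Y).
Proof.
move=> [c fE]; exists (fun S => a * c S) => Y.
by rewrite fE mulr_sumr; apply: eq_bigr => S _; rewrite mulrA.
Qed.

Lemma lowdeg_sum (I J : finType) (K : fieldType) d (f : J -> {set I} -> K) :
  (forall j, lowdeg d (f j)) -> lowdeg d (fun Y => \sum_j f j Y).
Proof.
move=> /boolp.choice [c fE]; exists (fun S => \sum_j c j S) => Y.
under eq_bigr => j _ do rewrite fE.
by rewrite exchange_big; apply: eq_bigr => S _; rewrite mulr_suml.
Qed.

Lemma lowdegS (I : finType) (K : fieldType) d (f : {set I} -> K) :
  lowdeg d f -> lowdeg d.+1 f.
Proof.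
move=> [c fE]; exists (fun S : {set I} => if (#|S| <= d)%N then c S else 0) => Y.
rewrite fE big_mkcond [RHS]big_mkcond; apply: eq_bigr => S _.
by case: (leqP #|S| d) => [/leqW->|_]//; rewrite mul0r if_same.
Qed.

(** Multiplying by a variable sends the monomial of [S] to that of [i |: S]:
    variables are idempotent on the cube. *)
Lemma lowdeg_mul_var (I : finType) (K : fieldType) d i (f : {set I} -> K) :
  lowdeg d f -> lowdeg d.+1 (fun Y => (i \in Y)%:R * f Y).
Proof.
move=> [c fE].
exists (fun T => \sum_(S : {set I} | (#|S| <= d)%N && (i |: S == T)) c S) => Y.
rewrite fE mulr_sumr.
rewrite (partition_big (fun S : {set I} => i |: S) (fun T : {set I} => (#|T| <= d.+1)%N)).
  apply: eq_bigr => T _; rewrite mulr_suml; apply: eq_bigr => S /andP[_ /eqP<-].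
  by rewrite subUset sub1set -mulnb natrM mulrCA mulrA.
by move=> S Sd; rewrite cardsU1 (leq_add (leq_b1 _) Sd).
Qed.

Lemma lowdeg_cst (I : finType) (K : fieldType) d (a : K) :
  lowdeg d (fun _ : {set I} => a).
Proof.
exists (fun S => a * (S == set0)%:R) => Y.
rewrite (bigD1 set0) ?cards0//= eqxx sub0set !mulr1 big1 ?addr0// => S.
by move=> /andP[_ /negbTE->]; rewrite mulr0 mul0r.
Qed.

Lemma lowdeg_exp_affine (I : finType) (K : fieldType) d (a : K) (b : I -> K) :
  lowdeg d (fun Y : {set I} => (a + \sum_i b i * (i \in Y)%:R) ^+ d).
Proof.
elim: d => [|d IH]; first exact: lowdeg_cst.
have -> : (fun Y : {set I} => (a + \sum_i b i * (i \in Y)%:R) ^+ d.+1) =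
  (fun Y => a * (a + \sum_i b i * (i \in Y)%:R) ^+ d +
     \sum_i b i * ((i \in Y)%:R * (a + \sum_i b i * (i \in Y)%:R) ^+ d)).
  apply/boolp.funext => Y; rewrite exprS mulrDl mulr_suml.
  by congr (_ + _); apply: eq_bigr => i _; rewrite mulrA.
apply: lowdegD; first exact/lowdegZ/lowdegS.
by apply: lowdeg_sum => i; apply: lowdegZ; apply: lowdeg_mul_var.
Qed.

(** Dimension bound of the polynomial method: the identity matrix indexed by [F]
    factors through the space of monomials of degree at most [d]. *)
Lemma lowdeg_independent (I : finType) (K : fieldType) d (F : {set {set I}})
    (f : {set I} -> {set I} -> K) :
  (forall X, lowdeg d (f X)) ->
  {in F &, forall X Y, f X Y = (X == Y)%:R} ->
  (#|F| <= #|[set S : {set I} | (#|S| <= d)%N]|)%N.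
Proof.
move=> /boolp.choice[c fE] fF; set D := [set S : {set I} | _].
pose A := \matrix_(x < #|F|, s < #|D|) c (enum_val x) (enum_val s).
pose B : 'M[K]_(#|D|, #|F|) := \matrix_(s, y)
  ((enum_val s : {set I}) \subset (enum_val y : {set I}))%:R.
have AB : A *m B = 1%:M.
  apply/matrixP => x y; rewrite !mxE.
  transitivity (f (enum_val x) (enum_val y)).
    rewrite fE; under eq_bigr => s _ do rewrite !mxE.
    rewrite -(big_enum_val
      (fun S : {set I} => c (enum_val x) S * (S \subset (enum_val y : {set I}))%:R)).
    by apply: eq_bigl => S; rewrite inE.
  by rewrite fF ?enum_valP// (inj_eq enum_val_inj).
by rewrite -(mxrank1 K #|F|) -AB (leq_trans (mxrankM_maxl _ _))// rank_leq_col.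
Qed.

(** The Hamming distance to a fixed point is an affine function on the cube. *)
Lemma sdistE (I : finType) (K : comNzRingType) (X Y : {set I}) :
  (sdist X Y)%:R = #|X|%:R + \sum_i (1 - (i \in X)%:R *+ 2) * (i \in Y)%:R :> K.
Proof.
have cE (Z : {set I}) : #|Z|%:R = \sum_i (i \in Z)%:R :> K.
  by rewrite -sum1_card natr_sum big_mkcond; apply: eq_bigr => i _; case: ifP.
rewrite /sdist natrD !cE -!big_split; apply: eq_bigr => i _ /=.
by rewrite !inE; case: (i \in X); case: (i \in Y) => /=; ring.
Qed.

Lemma sdist_eq0 (I : finType) (X Y : {set I}) : sdist X Y = 0%N -> X = Y.
Proof.
move=> /eqP; rewrite addn_eq0 !cards_eq0 !setD_eq0 => /andP[XY YX].
by apply/eqP; rewrite eqEsubset XY.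
Qed.

Lemma sdist_card (I : finType) (X Y : {set I}) :
  (sdist X Y + (#|X :&: Y|).*2 = #|X| + #|Y|)%N.
Proof.
rewrite /sdist -[in RHS](cardsID Y X) -[in RHS](cardsID X Y) [Y :&: X]setIC.
by rewrite -addnn addnACA addnC [in LHS]addnC addnACA addnC addnACA.
Qed.

Lemma sdist_le (I : finType) (X Y : {set I}) : (sdist X Y <= #|I|)%N.
Proof.
rewrite /sdist -cardsUI -[X in (_ + X <= _)%N](_ : 0 = _)%N ?addn0 ?max_card//.
apply/esym/eqP; rewrite cards_eq0; apply/eqP/setP => i; rewrite !inE.
by case: (i \in X); rewrite ?andbF.
Qed.

(** Inside a parity class all distances are even, so among the multiples of the
    odd prime [p] only [0] and [2 * p] can occur.  If [2 * p] does not, Fermat's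
    little theorem makes [1 - (sdist X Y)%:R ^+ p.-1] the identity matrix over
    the field with [p] elements, while it has degree at most [p.-1] in [Y]. *)
Lemma frankl_wilson_parity (p : nat) (F : {set {set 'I_(3 * p)}}) (b : bool) :
  prime p -> odd p -> {in F, forall X : {set _}, odd #|X| = b} ->
  {in F &, forall X Y, sdist X Y <> (2 * p)%N} ->
  (#|F| <= #|[set S : {set 'I_(3 * p)} | (#|S| <= p.-1)%N]|)%N.
Proof.
move=> pp op Fb FN; pose K := 'F_p.
apply: (@lowdeg_independent _ K _ _ (fun X Y => 1 - (sdist X Y)%:R ^+ p.-1)) =>
  [X|X Y XF YF].
  have -> : (fun Y => 1 - (sdist X Y)%:R ^+ p.-1 : K) = (fun Y => 1 + (-1) *
      (#|X|%:R + \sum_i (1 - (i \in X)%:R *+ 2) * (i \in Y)%:R : K) ^+ p.-1).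
    by apply/boolp.funext => Y; rewrite mulN1r -sdistE.
  by apply: lowdegD; [exact: lowdeg_cst | exact/lowdegZ/lowdeg_exp_affine].
case: eqVneq => [<-|XY].
  rewrite (_ : sdist X X = 0%N); last by rewrite /sdist setDv cards0.
  by rewrite expr0n -(subnKC (prime_gt1 pp))/= subr0.
suff d0 : (sdist X Y)%:R != 0 :> K.
  apply/eqP; rewrite subr_eq0 eq_sym -(inj_eq (mulfI d0)) mulr1 -exprS.
  by rewrite prednK ?prime_gt0// -[X in _ ^+ X](card_Fp pp) expf_card.
have dchar : p \in [pchar K] by exact: pchar_Fp.
rewrite -(dvdn_pcharf dchar); apply/negP => /dvdnP[m dE].
have d0 : sdist X Y != 0%N by apply: contra_neq XY; exact: sdist_eq0.
have dle : (sdist X Y <= 3 * p)%N by rewrite (leq_trans (sdist_le X Y))// card_ord.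
have dev : ~~ odd (sdist X Y).
  have /(congr1 odd) := sdist_card X Y.
  by rewrite !oddD odd_double addbF (Fb _ XF) (Fb _ YF) addbb => ->.
move: d0 dle dev; rewrite dE muln_eq0 leq_pmul2r ?prime_gt0// oddM op andbT.
have d2 : m != 2%N by apply: contra_notN (FN _ _ XF YF) => /eqP m2; rewrite dE m2.
by case: m d2 {dE} => [|[|[|[|m]]]].
Qed.

Lemma frankl_wilson (p : nat) (F : {set {set 'I_(3 * p)}}) :
  prime p -> odd p ->
  (2 * #|[set S : {set 'I_(3 * p)} | (#|S| <= p.-1)%N]| < #|F|)%N ->
  exists X Y, [/\ X \in F, Y \in F & sdist X Y = (2 * p)%N].
Proof.
move=> pp op Flt; apply: boolp.contrapT => NF.
move: Flt; apply/negP; rewrite -leqNgt.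
pose P := [set X : {set 'I_(3 * p)} | odd #|X|].
rewrite -(cardsID P F) mul2n -addnn.
have FN X Y : X \in F -> Y \in F -> sdist X Y <> (2 * p)%N.
  by move=> XF YF XY; apply: NF; exists X, Y.
apply: leq_add.
  apply: (@frankl_wilson_parity _ _ true) => // X.
    by rewrite !inE => /andP[_ ->].
  by move=> Y; rewrite !inE => /andP[? _] /andP[? _]; exact: FN.
apply: (@frankl_wilson_parity _ _ false) => // X.
  by rewrite !inE => /andP[/negbTE].
by move=> Y; rewrite !inE => /andP[_ ?] /andP[_ ?]; exact: FN.
Qed.

(** Chernoff-type bound: give the set [S] the weight [2 ^ (3 * p - #|S|)]; the total
    weight is [3 ^ (3 * p)], and a set of fewer than [p] elements weighs at least
    [4 ^ p]. *)
Lemma card_small_sets (p : nat) : (0 < p)%N ->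
  (#|[set S : {set 'I_(3 * p)} | (#|S| <= p.-1)%N]| * 4 ^ p <= 27 ^ p)%N.
Proof.
move=> p0; set V := [set S | _].
rewrite (_ : 27 ^ p = \sum_(S : {set 'I_(3 * p)}) 2 ^ (3 * p - #|S|))%N; last first.
  have /= := @bigA_distr _ _ _ muln addn _ (fun _ : 'I_(3 * p) => 1%N) (fun _ => 2%N).
  move=> /(_ 1%N); rewrite big_const_ord iter_muln_1 (expnM 3 3 p) => ->.
  apply: eq_bigr => S _.
  have -> : (3 * p - #|S|)%N = #|~: S| by rewrite [RHS]cardsCs setCK card_ord.
  rewrite (bigID (mem S))/= big1 ?mul1n => [|i ->//].
  rewrite -prod_nat_const [RHS](eq_bigl (fun i => i \notin S)) => [|i].
    by apply: eq_bigr => i /negbTE ->.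
  by rewrite inE.
rewrite -sum_nat_const big_mkcond; apply: leq_sum => S _.
case: ifP => //; rewrite inE => Sp; rewrite -(expnM 2 2) leq_exp2l//.
by lia.
Qed.

From mathcomp Require Import all_classical all_reals all_analysis.
From mathcomp Require Import complex measurable_realfun.
Import numFieldNormedType.Exports.
Local Open Scope classical_set_scope.

(** * Recurrence along differences of subset sums *)

Lemma measurable_iter d (X : measurableType d) (T : X -> X) m :
  measurable_fun setT T -> measurable_fun setT (iter m T).
Proof.
move=> mT; elim: m => [|m IH]; first exact: measurable_id.
exact: (measurableT_comp mT IH).
Qed.

Lemma measure_preserving_iter (R : realType) d (X : measurableType d)
    (mu : probability X R) (T : X -> X) m A :
  measure_preserving mu T -> measurable A -> mu (iter m T @^-1` A) = mu A.
Proof.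
move=> [mT muT] mA; elim: m => [//|m IH].
rewrite -[RHS]IH -[RHS]muT; last first.
  by rewrite -[X in measurable X]setTI; exact: measurable_iter.
by congr (mu _); apply/seteqP; split => x; rewrite /preimage/= -iterS iterSr.
Qed.

(** Let [G] be the family of the [S] with [x \in F S].  Pointwise in [x], either [G] is
    no larger than the Frankl-Wilson threshold or it contains a pair at distance
    [2 * p]; hence [#|G|] is at most the threshold plus [8 ^ p] times the number of
    such pairs.  Integrate this inequality: there are [8 ^ p] sets [S] and at most
    [64 ^ p] pairs. *)
Lemma cube_pigeonhole (R : realType) d (X : measurableType d)
    (mu : probability X R) (p : nat) (F : {set 'I_(3 * p)} -> set X) (a c : R) :
  prime p -> odd p ->
  (forall S, measurable (F S)) ->
  (forall S, a%:E <= mu (F S))%E ->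
  (forall S S', sdist S S' = (2 * p)%N -> mu (F S `&` F S') <= c%:E)%E ->
  0 <= c ->
  8 ^+ p * a <=
   (2 * #|[set S : {set 'I_(3 * p)} | (#|S| <= p.-1)%N]%SET|)%:R + 8 ^+ p * (64 ^+ p * c).
Proof.
move=> pp op mF aF cF c0; set V := (2 * _)%N.
pose P := [pred q : {set 'I_(3 * p)} * {set 'I_(3 * p)} | sdist q.1 q.2 == 2 * p]%N.
have c8 : #|{set 'I_(3 * p)}| = (8 ^ p)%N.
  by rewrite -cardsT -powersetT card_powerset cardsT card_ord (expnM 2 3).
(* the pointwise inequality *)
have key x : (\sum_(S : {set 'I_(3 * p)}) (\1_(F S) x)%:E <=
   V%:R%:E + (8 ^ p)%:R%:E * \sum_(q <- enum P) (\1_(F q.1 `&` F q.2) x : R)%:E)%E.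
  rewrite !sumEFin -EFinM -EFinD lee_fin.
  pose G := [set S : {set 'I_(3 * p)} | x \in F S]%SET.
  have -> : \sum_S \1_(F S) x = #|G|%:R :> R.
    rewrite -sum1_card natr_sum [RHS]big_mkcond; apply: eq_bigr => S _.
    by rewrite indicE inE; case: (x \in F S).
  have [GV|GV] := leqP #|G| V.
    rewrite (@le_trans _ _ V%:R) ?ler_nat// lerDl mulr_ge0//.
    by rewrite sumr_ge0.
  have [S [S' [SG S'G SS']]] := frankl_wilson pp op GV.
  rewrite -[leLHS]add0r lerD// -[leLHS]mulr1 ler_pM ?ler_nat//.
    by rewrite -c8 max_card.
  rewrite big_enum_cond/= (bigD1 (S, S'))/=; last first.
    by rewrite andbT inE/=; apply/eqP.
  rewrite indicE (_ : _ \in _ = true) ?lerDl ?sumr_ge0//.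
  by move: SG S'G; rewrite !inE => SG S'G; apply/mem_set; split.
have mI S S' : measurable (F S `&` F S') by exact: measurableI.
have mind B : measurable B -> measurable_fun setT (fun x : X => (\1_B x : R)%:E).
  by move=> mB; apply/measurable_EFinP; exact: measurable_indic.
have msum : measurable_fun setT
    (fun x : X => \sum_(q <- enum P) (\1_(F q.1 `&` F q.2) x : R)%:E)%E.
  by apply: emeasurable_sum => q; exact: mind.
have sum0 (x : X) : (0 <= \sum_(q <- enum P) (\1_(F q.1 `&` F q.2) x : R)%:E)%E.
  by apply: sume_ge0 => q _; rewrite lee_fin.
have : (\int[mu]_x \sum_(S : {set 'I_(3 * p)}) (\1_(F S) x : R)%:E <= \int[mu]_x
   (V%:R%:E + (8 ^ p)%:R%:E * \sum_(q <- enum P) (\1_(F q.1 `&` F q.2) x : R)%:E))%E.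
  apply: ge0_le_integral => //.
  - by move=> x _; apply: sume_ge0 => S _; rewrite lee_fin.
  - by apply: emeasurable_sum => S; exact: mind.
  - by apply: emeasurable_funD => //; exact: emeasurable_funM.
rewrite ge0_integral_sum//; last by move=> S; exact: mind.
rewrite ge0_integralD//; last 2 first.
  - by move=> x _; rewrite mule_ge0 ?lee_fin.
  - exact: emeasurable_funM.
rewrite ge0_integralZl//.
rewrite ge0_integral_sum//; last by move=> q; exact: mind.
rewrite integral_cst//.
under eq_bigr => S _ do rewrite integral_indic// setIT.
under [X in (_ <= _ + _ * X)%E -> _]eq_bigr => S _ do rewrite integral_indic// setIT.
rewrite [X in (_ * X + _)%E](_ : _ = 1%E) ?mule1; last exact: probability_setT.
move=> H.
have : (((8 ^ p)%:R * a)%:E <= (V%:R + (8 ^ p)%:R * ((64 ^ p)%:R * c))%:E)%E.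
  apply: (le_trans _ (le_trans H _)).
    rewrite -c8 -sum1_card natr_sum mulr_suml -sumEFin; apply: lee_sum => S _.
    by rewrite mul1r; exact: aF.
  rewrite EFinD leeD2l// EFinM lee_wpmul2l ?lee_fin//.
  apply: (@le_trans _ _ (\sum_(q <- enum P) c%:E)%E).
    rewrite !big_seq; apply: lee_sum => q; rewrite mem_enum inE => /eqP; exact: cF.
  rewrite sumEFin lee_fin big_const_seq count_predT iter_addr_0.
  rewrite -[leLHS]mulr_natl ler_wpM2r// ler_nat.
  rewrite -[size _](cardE P) (leq_trans (max_card _))// card_prod c8 -expnMn.
  by [].
by rewrite lee_fin !natrX.
Qed.

(** * Measures on the torus from measures on the line *)

(** An alias of [m] that remembers the bound, so that the finite measure structure
    can be attached to it. *)
Definition finite_copy (R : realType) d (T : measurableType d)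
  (m : {measure set T -> \bar R}) (_ : (m setT < +oo)%E) : set T -> \bar R := m.

Section finite_copy.
Context (R : realType) d (T : measurableType d) (m : {measure set T -> \bar R})
  (moo : (m setT < +oo)%E).

HB.instance Definition _ := Measure.copy (finite_copy moo) m.

Let finite_copy_fin : fin_num_fun (finite_copy moo).
Proof.
move=> A mA; rewrite ge0_fin_numE//; apply: le_lt_trans moo.
by apply: le_measure; rewrite ?inE.
Qed.

HB.instance Definition _ :=
  @Measure_isFinite.Build _ T R (finite_copy moo) finite_copy_fin.
End finite_copy.

Lemma periodic2pi_int (R : realType) (f : R -> R) (x z : R) :
  periodic f (pi *+ 2) -> z \is a Num.int -> f (2 * pi * (x + z)) = f (2 * pi * x).
Proof.
move=> fper; have nat_case (n : nat) y : f (2 * pi * (y + n%:R)) = f (2 * pi * y).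
  have -> : 2 * pi * (y + n%:R) = 2 * pi * y + (pi *+ 2) *+ n.
    by rewrite -[in RHS]mulr_natr -[in RHS]mulr_natr; ring.
  exact: (periodicn fper).
move=> /intrP[[n|n] ->]; first exact: nat_case.
by rewrite -(nat_case n.+1) NegzE mulrNz/= subrK.
Qed.

Lemma cosDint (R : realType) (x z : R) :
  z \is a Num.int -> cos (2 * pi * (x + z)) = cos (2 * pi * x).
Proof. exact: periodic2pi_int (@cosD2pi R). Qed.

Lemma sinDint (R : realType) (x z : R) :
  z \is a Num.int -> sin (2 * pi * (x + z)) = sin (2 * pi * x).
Proof. exact: periodic2pi_int (@sinD2pi R). Qed.

Definition to_torus (R : realType) (x : measurableTypeR R) : borel_torus R :=
  (\pi_(torus R) (x : R))%qT.

Lemma measurable_to_torus (R : realType) : measurable_fun setT (@to_torus R).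
Proof.
apply: (@measurability _ _ (measurableTypeR R) (borel_torus R) _ _ (@open (torus R)) erefl).
move=> _ [B oB <-]; rewrite setTI; apply: open_measurable.
have := @pi_continuous R (Quotient.quot (int_subgroup R)).
by move/continuousP; apply.
Qed.

Lemma measurable_borel_torus_continuous (R : realType) (f : torus R -> R) :
  continuous f -> measurable_fun setT (f : borel_torus R -> measurableTypeR R).
Proof.
move=> /continuousP cf.
apply: (measurability _ (RGenOInfty.measurableE R)) => //.
move=> _ [_ [x ->] <-]; rewrite setTI; apply: sub_sigma_algebra.
by apply: cf; exact: rray_open.
Qed.

Lemma repr_to_torus (R : realType) (x : R) :
  (repr (to_torus x : torus R) : R) - x \is a Num.int.
Proof. by apply/torus_eqP; rewrite reprK. Qed.

Lemma continuous_torus_lift (R : realType) (f : R -> R) :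
  continuous f -> (forall x z, z \is a Num.int -> f (x + z) = f x) ->
  continuous (fun t : torus R => f (repr t)).
Proof.
move=> cf fint; apply: (@repr_comp_continuous R (Quotient.quot (int_subgroup R)) _ f cf).
move=> x y /eqP xy.
have /torus_eqP/fint yx : (x = y %[mod torus R])%qT by exact: xy.
by rewrite -[in eqbLHS](subrK y x) addrC yx.
Qed.

Lemma measurable_torus_lift (R : realType) (f : R -> R) :
  continuous f -> (forall x z, z \is a Num.int -> f (x + z) = f x) ->
  measurable_fun setT (fun t : borel_torus R => f (repr (t : torus R)) : measurableTypeR R).
Proof.
by move=> cf fint; apply: measurable_borel_torus_continuous; exact: continuous_torus_lift.
Qed.

Lemma torus_lift_to_torus (R : realType) (f : R -> R) x :
  (forall x z, z \is a Num.int -> f (x + z) = f x) ->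
  f (repr (to_torus x : torus R)) = f x.
Proof.
move=> fint; rewrite -[LHS](_ : f (x + (repr (to_torus x : torus R) - x)) = _).
  by apply: fint; exact: repr_to_torus.
by rewrite addrC subrK.
Qed.

(** The push-forward, carrying the measurability of [f] so that it is recognized
    as a measure without further hints. *)
Definition image_measure (R : realType) d d' (X : measurableType d)
    (Y : measurableType d') (f : X -> Y) (_ : measurable_fun setT f)
    (m : {measure set X -> \bar R}) : set Y -> \bar R := pushforward m f.

Section image_measure.
Context (R : realType) d d' (X : measurableType d) (Y : measurableType d').
Context (f : X -> Y) (mf : measurable_fun setT f) (m : {measure set X -> \bar R}).

HB.instance Definition _ := Measure.copy (image_measure mf m)
  (@measure_function_pushforward__canonical__measure_function_Measure
    _ _ _ _ R m f mf).
End image_measure.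

Lemma bounded_integrable (R : realType) d (T : measurableType d)
    (m : {measure set T -> \bar R}) (D : set T) (f : T -> R) (C : R) :
  measurable D -> (m D < +oo)%E -> measurable_fun setT f -> (forall x, `|f x| <= C) ->
  m.-integrable D (EFin \o f).
Proof.
move=> mD moo mf fC; apply: measurable_bounded_integrable => //.
  exact: measurable_funTS.
exists C; split; first exact: num_real.
by move=> M CM x _; apply: (le_trans (fC x)); exact: ltW.
Qed.

Lemma Rintegral_image (R : realType) d d' (X : measurableType d)
    (Y : measurableType d') (f : X -> Y) (mf : measurable_fun setT f)
    (m : {measure set X -> \bar R}) (g : Y -> R) (C : R) :
  (m setT < +oo)%E -> measurable_fun setT g -> (forall y, `|g y| <= C) ->
  Rintegral (image_measure mf m) setT g = Rintegral m setT (g \o f).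
Proof.
move=> moo mg gC; rewrite /Rintegral; congr fine.
rewrite /image_measure (integral_pushforward mf)// ?preimage_setT//.
  exact/measurable_EFinP.
by rewrite compA; apply: (@bounded_integrable _ _ _ _ _ _ C) => //; exact: measurableT_comp.
Qed.

Lemma Rintegral_measure_add (R : realType) d (T : measurableType d)
    (m1 m2 : {measure set T -> \bar R}) (f : T -> R) (C : R) :
  (m1 setT < +oo)%E -> (m2 setT < +oo)%E ->
  measurable_fun setT f -> (forall x, `|f x| <= C) ->
  Rintegral (measure_add m1 m2) setT f = Rintegral m1 setT f + Rintegral m2 setT f.
Proof.
move=> m1oo m2oo mf fC.
have i1 := bounded_integrable measurableT m1oo mf fC.
have i2 := bounded_integrable measurableT m2oo mf fC.
rewrite /Rintegral integral_measure_add//.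
by rewrite fineD//; exact: integrable_fin_num.
Qed.

(** It suffices to work on the real line and with cosines only.  Take the sum of
    the images of [tau] under [x |-> x] and [x |-> - x] modulo [1]: its sine
    coefficients vanish by oddness, its cosine coefficients double, and the atom
    at [0] survives. *)
Lemma not_vdC_criterion (R : realType) (D : set nat)
    (tau : {measure set (measurableTypeR R) -> \bar R}) :
  (tau setT < +oo)%E -> (0 < tau [set 0%R])%E ->
  (forall h, D h -> Rintegral tau setT (fun x : R => cos (2 * pi * (h%:R * x))) = 0) ->
  ~ vdC_set R D.
Proof.
move=> tauoo tau0 tauD [_ vD].
have mN : measurable_fun setT (fun x : measurableTypeR R => to_torus (- (x : R))).
  apply: (measurableT_comp (@measurable_to_torus R)).
  exact: oppr_measurable.
pose m1 : {measure set (borel_torus R) -> \bar R} :=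
  image_measure (@measurable_to_torus R) tau.
pose m2 : {measure set (borel_torus R) -> \bar R} := image_measure mN tau.
have m1oo : (m1 setT < +oo)%E by rewrite /m1/= /image_measure /pushforward preimage_setT.
have m2oo : (m2 setT < +oo)%E by rewrite /m2/= /image_measure /pushforward preimage_setT.
have soo : (measure_add m1 m2 setT < +oo)%E by rewrite measure_addE lte_add_pinfty.
pose sigma : {finite_measure set (borel_torus R) -> \bar R} := finite_copy soo.
have zero t : sigma [set t] = 0%E.
  apply: vD => h Dh; rewrite /fourier_coef /complex_integral.
  have scale (x z : R) : z \is a Num.int ->
      [/\ cos (2 * pi * (h%:R * (x + z))) = cos (2 * pi * (h%:R * x)) &
       sin (2 * pi * (h%:R * (x + z))) = sin (2 * pi * (h%:R * x))].
    move=> zint; have hz : h%:R * z \is a Num.int by apply: rpredM => //; exact: natr_int.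
    by rewrite [h%:R * (x + z)]mulrDr (cosDint _ hz) (sinDint _ hz).
  have clin : continuous (fun x : R => 2 * pi * (h%:R * x)).
    by move=> x; apply: cvgM; [exact: cvg_cst|apply: cvgM; [exact: cvg_cst|exact: cvg_id]].
  have ccos : continuous (fun x : R => cos (2 * pi * (h%:R * x))).
    by move=> x; exact: (@continuous_comp R R R _ cos x (clin x) (@continuous_cos R _)).
  have csin : continuous (fun x : R => sin (2 * pi * (h%:R * x))).
    by move=> x; exact: (@continuous_comp R R R _ sin x (clin x) (@continuous_sin R _)).
  (* integration of a 1-periodic function against the symmetrized image *)
  have int (f : R -> R) : continuous f ->
      (forall x z, z \is a Num.int -> f (x + z) = f x) -> (forall x, `|f x| <= 1) ->
      Rintegral sigma setT (fun t : borel_torus R => f (repr (t : torus R))) =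
      Rintegral tau setT f + Rintegral tau setT (fun x => f (- x)).
    move=> cf fint f1; rewrite [LHS](@Rintegral_measure_add _ _ _ m1 m2 _ 1)//.
    - rewrite !(@Rintegral_image _ _ _ _ _ _ _ _ _ 1)//; last 2 first.
      + exact: measurable_torus_lift.
      + exact: measurable_torus_lift.
      by congr (_ + _); apply: eq_Rintegral => x _ /=; rewrite torus_lift_to_torus.
    - exact: measurable_torus_lift.
  congr (_ +i* _)%C.
  - under eq_Rintegral => t' _ do rewrite /= cosN -mulrA.
    rewrite (int (fun x => cos (2 * pi * (h%:R * x))))//; last 2 first.
    + by move=> x z /(scale x)[].
    + by move=> x; exact: cos_max.
    rewrite tauD// add0r -[RHS](tauD h Dh).
    by apply: eq_Rintegral => x _; rewrite !mulrN cosN.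
  - under eq_Rintegral => t' _ do rewrite /= sinN -mulrA.
    rewrite (int (fun x => - sin (2 * pi * (h%:R * x))))//; last 3 first.
    + by move=> x; apply: cvgN; exact: csin.
    + by move=> x z /(scale x)[_ ->].
    + by move=> x; rewrite normrN; exact: sin_max.
    under [X in _ + X]eq_Rintegral => x _ do rewrite !mulrN sinN -[- - _]mulN1r.
    rewrite RintegralZl//; first by rewrite mulN1r subrr.
    apply: (@bounded_integrable _ _ _ _ _ _ 1) => //.
      apply: continuous_measurable_fun => x; apply: cvgN; exact: csin.
    by move=> x; rewrite normrN; exact: sin_max.
have : measure_add m1 m2 [set to_torus 0] = 0%E := zero (to_torus 0).
rewrite measure_addE; apply/eqP; rewrite gt_eqF//.
apply: (@lt_le_trans _ _ (m1 [set to_torus 0])); last by rewrite leeDl.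
apply: (lt_le_trans tau0); rewrite /m1/= /image_measure /pushforward.
apply: le_measure; rewrite ?inE; [exact: measurable_set1| |by move=> x ->].
(* the preimage of the class of 0 is the set of integers *)
apply: countable_measurable; first by move=> x; exact: measurable_set1.
apply: (@sub_countable _ _ _ [set (z%:~R : R) | z in [set: int]]).
  apply: subset_card_le => x /= x0.
  have /torus_eqP : (x = 0 %[mod torus R])%qT by exact: x0.
  by rewrite subr0 => /intrP[z ->]; exists z.
exact: (sub_countable (card_image_le _ _) (countableP _)).
Qed.

(** * Densities and cosine integrals *)

(** The measure of density [g] with respect to [mu]; the proof arguments are those
    the measure instance depends on. *)
Definition density_measure (R : realType) d (T : measurableType d)
    (mu : {measure set T -> \bar R}) (g : T -> R)
    (_ : measurable_fun setT g) (_ : forall x, 0 <= g x) : set T -> \bar R :=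
  fun A => (\int[mu]_(x in A) (g x)%:E)%E.

Section density_measure.
Context (R : realType) d (T : measurableType d) (mu : {measure set T -> \bar R})
  (g : T -> R) (mg : measurable_fun setT g) (g0 : forall x, 0 <= g x).
Local Open Scope ereal_scope.

Let density0 : density_measure mu mg g0 set0 = 0.
Proof. exact: integral_set0. Qed.

Let density_ge0 A : 0 <= density_measure mu mg g0 A.
Proof. by apply: integral_ge0 => x _; rewrite lee_fin. Qed.

Let density_sigma_additive : semi_sigma_additive (density_measure mu mg g0).
Proof.
apply: semi_sigma_additive_nng_induced; first exact/measurable_EFinP.
by move=> x; rewrite lee_fin.
Qed.

HB.instance Definition _ := isMeasure.Build _ _ _ (density_measure mu mg g0)
  density0 density_ge0 density_sigma_additive.
End density_measure.

(** The Radon-Nikodym derivative of the density measure is [g] almost everywhere,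
    so this is the change of variables for that derivative. *)
Lemma Rintegral_density (R : realType) d (T : measurableType d)
    (mu : {sigma_finite_measure set T -> \bar R}) (g : T -> R)
    (mg : measurable_fun setT g) (g0 : forall x, 0 <= g x) (f : T -> R) (C : R) :
  mu.-integrable setT (EFin \o g) ->
  measurable_fun setT f -> (forall x, `|f x| <= C) ->
  Rintegral (density_measure mu mg g0) setT f =
  Rintegral mu setT (fun x => f x * g x).
Proof.
move=> ig mf fC.
have doo : (density_measure mu mg g0 setT < +oo)%E.
  rewrite -ge0_fin_numE; first exact: integrable_fin_num ig.
  exact: measure_ge0.
pose nu : {finite_measure set T -> \bar R} := finite_copy doo.
have numu : nu `<< mu.
  apply/null_content_dominatesP => A mA muA0.
  apply: null_set_integral => //; apply/measurable_EFinP; exact: measurable_funTS.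
rewrite /Rintegral; congr fine.
rewrite -[LHS](Radon_Nikodym_change_of_variables numu measurableT); last first.
  exact: (bounded_integrable measurableT doo mf fC).
have RNg : ae_eq mu setT (Radon_Nikodym (charge_of_finite_measure nu) mu) (EFin \o g).
  apply: integral_ae_eq => //.
  - exact: Radon_Nikodym_integrable.
  - exact/measurable_EFinP.
  - by move=> E _ mE; rewrite -Radon_Nikodym_integral.
apply: ae_eq_integral => //.
- apply: emeasurable_funM => //; first exact/measurable_EFinP.
- by apply/measurable_EFinP; exact: measurable_funM.
- by apply: filterS RNg => x /= H /H ->; rewrite EFinM.
Qed.

Lemma continuous_cos_lin (R : realType) (a : R) : continuous (fun x : R => cos (a * x)).
Proof.
move=> x; apply: (@continuous_comp R R R _ cos x _ (@continuous_cos R _)).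
by apply: cvgM; [exact: cvg_cst|exact: cvg_id].
Qed.

Lemma integral_cos_freq (R : realType) (m : R) : m \is a Num.int ->
  Rintegral (@lebesgue_measure R) `[0%R, 1%R]%classic (fun x : R => cos (2 * pi * m * x)) =
  (m == 0)%:R.
Proof.
move=> mint; have [->|m0] := eqVneq.
  under eq_Rintegral => x _ do rewrite mulr0 mul0r cos0.
  by rewrite Rintegral_cst//= lebesgue_measure_itv/= lte01 oppr0 adde0/= mulr1.
have w0 : 2 * pi * m != 0 :> R by rewrite !mulf_neq0// gt_eqF// pi_gt0.
set w := 2 * pi * m in w0 *.
pose F (x : R) := w^-1 * sin (w * x).
have dF (x : R) : is_derive x 1 F (cos (w * x)).
  have dw : is_derive x (1 : R) (fun y : R => w * y) w.
    have H : is_derive x (1 : R) (w \*: (@id R)) (w *: (1 : R)) by apply: is_deriveZ.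
    by apply: is_derive_eq; rewrite /GRing.scale/= mulr1.
  have ds : is_derive x (1 : R) (fun y => sin (w * y)) (cos (w * x) * w).
    exact: (@is_derive1_comp _ sin _ x _ _ (is_derive_sin _) dw).
  have H : is_derive x (1 : R) (w^-1 \*: (fun y => sin (w * y)) : R -> R)
    (w^-1 *: (cos (w * x) * w)) by apply: is_deriveZ.
  by apply: is_derive_eq; rewrite /GRing.scale/= mulrCA mulVf// mulr1.
rewrite /Rintegral (@continuous_FTC2 _ _ F)//.
- rewrite /F mulr0 sin0 mulr1 /w.
  have := sinDint 0 mint; rewrite add0r mulr0 sin0 => ->.
  by rewrite mulr0 subee.
- by apply: continuous_subspaceT; exact: continuous_cos_lin.
- have cF (x : R) : {for x, continuous F}.
    exact/differentiable_continuous/derivable1_diffP/(@ex_derive _ _ _ _ _ _ _ (dF x)).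
  split => [x _||].
  - exact: (@ex_derive _ _ _ _ _ _ _ (dF x)).
  - exact/cvg_at_right_filter/cF.
  - exact/cvg_at_left_filter/cF.
- by move=> x _; rewrite derive1E; rewrite (@derive_val _ _ _ _ _ _ _ (dF x)).
Qed.

(** * Correcting summable Fourier coefficients *)

Local Notation leb := (@lebesgue_measure _).
Local Notation I01 := (`[0%R, 1%R]%classic).
Local Notation J01 := (`[0%R, 1%R[%classic).

Lemma leb_I01 (R : realType) : @lebesgue_measure R I01 = 1%E.
Proof. by rewrite lebesgue_measure_itv/= lte01 oppr0 adde0. Qed.

Lemma leb_I01_lty (R : realType) : (@lebesgue_measure R I01 < +oo)%E.
Proof. by rewrite leb_I01 ltry. Qed.

Lemma leb_J01 (R : realType) : @lebesgue_measure R J01 = 1%E.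
Proof. by rewrite lebesgue_measure_itv/= lte01 oppr0 adde0. Qed.

Lemma leb_J01_lty (R : realType) : (@lebesgue_measure R J01 < +oo)%E.
Proof. by rewrite leb_J01 ltry. Qed.

Lemma integrable01 (R : realType) (f : R -> R) (C : R) :
  measurable_fun setT f -> (forall x, `|f x| <= C) ->
  leb.-integrable I01 (EFin \o f).
Proof. by move=> mf fC; apply: (@bounded_integrable _ _ _ _ _ _ C) => //; exact: leb_I01_lty. Qed.

Lemma ex_density01 (R : realType) (w : R -> R) (C : R) :
  measurable_fun setT w -> (forall x, 0 <= w x <= C) ->
  exists kappa : {measure set (measurableTypeR R) -> \bar R},
    (kappa setT < +oo)%E /\
    forall (f : R -> R) (M : R), measurable_fun setT f -> (forall x, `|f x| <= M) ->
      Rintegral kappa setT f = Rintegral leb I01 (fun x => f x * w x).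
Proof.
move=> mw wC; pose g := fun x : measurableTypeR R => w x * \1_I01 x.
have mg : measurable_fun setT g.
  by apply: measurable_funM => //; exact: measurable_indic.
have g0 x : 0 <= g x by rewrite mulr_ge0//; case/andP: (wC x).
have ig : leb.-integrable setT (EFin \o g).
  have -> : EFin \o g = (EFin \o w) \_ I01.
    apply/funext => x; rewrite /g patchE/= indicE.
    by case: (x \in _); rewrite ?mulr1 ?mulr0.
  apply/integrable_restrict => //; rewrite setTI; apply: (integrable01 (C := C)) => // x.
  by case/andP: (wC x) => w0 wCx; rewrite ger0_norm.
exists (density_measure leb mg g0); split.
  rewrite -ge0_fin_numE; first exact: integrable_fin_num ig.
  exact: measure_ge0.
move=> f M mf fM; rewrite (Rintegral_density mg g0 (C := M))//.
rewrite [RHS]Rintegral_mkcond; apply: eq_Rintegral => x _.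
by rewrite patchE /g indicE; case: (x \in _); rewrite ?mulr1 ?mulr0.
Qed.

Definition cosn (R : realType) (h : nat) (x : R) : R := cos (2 * pi * (h%:R * x)).

Lemma measurable_cosn (R : realType) h : measurable_fun setT (@cosn R h).
Proof.
have -> : @cosn R h = (fun x => cos (2 * pi * h%:R * x)).
  by apply/funext => x; rewrite /cosn mulrA.
by apply: continuous_measurable_fun; exact: continuous_cos_lin.
Qed.

Lemma cosn_max (R : realType) h (x : R) : `|cosn h x| <= 1.
Proof. exact: cos_max. Qed.

Lemma integral_cosn (R : realType) h :
  Rintegral leb I01 (@cosn R h) = (h == 0)%N%:R.
Proof.
rewrite -(eqr_nat R) -(@integral_cos_freq R h%:R) ?natr_int//.
by apply: eq_Rintegral => x _; rewrite /cosn mulrA.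
Qed.

Lemma integral_cosnM (R : realType) h k : (0 < k)%N ->
  Rintegral leb I01 (fun x : R => cosn h x * cosn k x) = (h == k)%:R / 2.
Proof.
move=> k0.
pose c (m x : R) := cos (2 * pi * m * x).
have mc m : measurable_fun setT (c m).
  by apply: continuous_measurable_fun; exact: continuous_cos_lin.
have c1 m x : `|c m x| <= 1 by exact: cos_max.
transitivity (Rintegral leb I01 (fun x : R => 2^-1 * (c (h%:R + k%:R) x + c (h%:R - k%:R) x))).
  apply: eq_Rintegral => x _; rewrite /cosn /c.
  have -> : 2 * pi * (h%:R + k%:R) * x = 2 * pi * (h%:R * x) + 2 * pi * (k%:R * x) by ring.
  have -> : 2 * pi * (h%:R - k%:R) * x = 2 * pi * (h%:R * x) - 2 * pi * (k%:R * x) by ring.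
  by rewrite cosD cosB; field.
rewrite RintegralZl//; last first.
  apply: (@integrable01 _ _ 2); first exact: measurable_funD.
  by move=> x; apply: (le_trans (ler_normD _ _)); rewrite (_ : 2 = 1 + 1)// lerD.
rewrite RintegralD//; [|exact: (@integrable01 _ _ 1)..].
rewrite !integral_cos_freq ?rpredB ?rpredD ?natr_int// -natrD pnatr_eq0.
by rewrite subr_eq0 eqr_nat addn_eq0 (gtn_eqF k0) andbF add0r mulrC.
Qed.

Lemma integrable01Z (R : realType) (c : R) (f : R -> R) :
  leb.-integrable I01 (EFin \o f) -> leb.-integrable I01 (EFin \o (fun x => c * f x)).
Proof.
move=> fi; rewrite (_ : EFin \o _ = (fun x => c%:E * (EFin \o f) x)%E) //.
by apply: integrableZl fi; exact: measurable_itv.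
Qed.

(** The density is the sum of the nonnegative functions
    [2 * (`|e h| + e h * cosn h x)].  By orthogonality of the cosines on the unit
    interval its coefficient at [k > 0] is [e k]; dominated convergence allows the
    termwise integration.  Positivity costs only the constant term, that is the
    coefficient at [0], which is left free. *)
Lemma ex_cosine_correction (R : realType) (e : nat -> R) (B : R) :
  (forall N, \sum_(h < N) `|e h| <= B) ->
  exists kappa : {measure set (measurableTypeR R) -> \bar R},
    (kappa setT < +oo)%E /\
    forall k, (0 < k)%N -> Rintegral kappa setT (cosn k) = e k.
Proof.
move=> eB.
pose a h (x : R) := 2 * (`|e h| + e h * cosn h x).
pose g_ N (x : R) := \sum_(h < N) a h x.
have ecos h x : `|e h * cosn h x| <= `|e h|.
  by rewrite normrM ler_piMr// cosn_max.
have a0 h x : 0 <= a h x.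
  by rewrite mulr_ge0// -(opprK (e h * _)) subr_ge0 (le_trans (ler_norm _))// normrN.
have g0 N x : 0 <= g_ N x by apply: sumr_ge0.
have gB N x : g_ N x <= 4 * B.
  apply: (@le_trans _ _ (4 * \sum_(h < N) `|e h|)); last by rewrite ler_pM2l.
  rewrite mulr_sumr; apply: ler_sum => h _; rewrite /a.
  have := le_trans (ler_norm _) (ecos h x); lra.
have gnd x : nondecreasing_seq (g_^~ x).
  by apply/nondecreasing_seqP => N; rewrite /g_ big_ord_recr/= lerDl.
have gcvg x : cvgn (g_^~ x).
  apply: nondecreasing_is_cvgn => //; exists (4 * B) => _ [N _ <-]; exact: gB.
pose g x := limn (g_^~ x).
have ma h : measurable_fun setT (a h).
  apply: measurable_funM => //.
  apply: measurable_funD => //; apply: measurable_funM => //; exact: measurable_cosn.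
have mg_ N : measurable_fun setT (g_ N) by apply: measurable_sum => h; exact: ma.
have mg : measurable_fun setT g.
  by apply: (measurable_fun_cvg (h := g_)) => // x _; exact: gcvg.
have gC x : 0 <= g x <= 4 * B.
  apply/andP; split; first by apply: limr_ge => //; exact: nearW.
  by apply: limr_le => //; exact: nearW.
have [kappa [kappaoo kappaE]] := ex_density01 mg gC.
exists kappa; split => // k k0.
rewrite (kappaE _ 1)//; [|exact: measurable_cosn|exact: cosn_max].
have aint h : Rintegral leb I01 (fun x => cosn k x * a h x) = e h * (h == k)%:R.
  transitivity (Rintegral leb I01
    (fun x => (2 * `|e h|) * cosn k x + (2 * e h) * (cosn h x * cosn k x))).
    by apply: eq_Rintegral => x _; rewrite /a; ring.
  have ic : leb.-integrable I01 (EFin \o @cosn R k).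
    by apply: (@integrable01 _ _ 1); [exact: measurable_cosn|exact: cosn_max].
  have icc : leb.-integrable I01 (EFin \o (fun x : R => cosn h x * cosn k x)).
    apply: (@integrable01 _ _ 1).
      by apply: measurable_funM; exact: measurable_cosn.
    by move=> x; rewrite normrM mulr_ile1// cosn_max.
  rewrite RintegralD//; last 2 first.
  - exact: integrable01Z ic.
  - exact: integrable01Z icc.
  rewrite !RintegralZl// integral_cosn integral_cosnM// (gtn_eqF k0).
  by rewrite mulr0 add0r; field.
have bound N x : `|cosn k x * g_ N x| <= 4 * B.
  rewrite normrM -[leRHS]mul1r ler_pM//; first exact: cosn_max.
  by rewrite ger0_norm.
have gint N : Rintegral leb I01 (fun x => cosn k x * g_ N x) =
    \sum_(h < N) e h * (h == k :> nat)%:R.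
  have am h x : `|cosn k x * a h x| <= 4 * `|e h|.
    rewrite normrM -[leRHS]mul1r ler_pM//; first exact: cosn_max.
    rewrite ger0_norm// /a; have := le_trans (ler_norm _) (ecos h x); lra.
  elim: N => [|N IH].
    under eq_Rintegral => x _ do rewrite /g_ big_ord0 mulr0.
    by rewrite big_ord0 Rintegral_cst//= mul0r.
  rewrite big_ord_recr/= -IH -aint -RintegralD//.
  - by apply: eq_Rintegral => x _; rewrite /g_ big_ord_recr/= mulrDr.
  - apply: (@integrable01 _ _ (4 * B)) => //.
    by apply: measurable_funM => //; exact: measurable_cosn.
  - apply: (@integrable01 _ _ (4 * `|e N|)) => //.
    by apply: measurable_funM => //; exact: measurable_cosn.
have lim : (\int[leb]_(x in I01) (cosn k x * g_ N x)%:E)%E @[N --> \oo] -->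
    (\int[leb]_(x in I01) (cosn k x * g x)%:E)%E.
  have mcg (f : R -> R) : measurable_fun setT f ->
      measurable_fun setT (fun x : R => (cosn k x * f x)%:E).
    move=> mf; apply/measurable_EFinP.
    by apply: measurable_funM => //; exact: (@measurable_cosn R k).
  have [] // := @dominated_convergence _ _ R leb I01 (measurable_itv _)
    (fun N x => (cosn k x * g_ N x)%:E) (fun x => (cosn k x * g x)%:E) (cst (4 * B)%:E).
  - by move=> N; apply: measurable_funTS; exact: mcg.
  - by apply: measurable_funTS; exact: mcg.
  - apply: aeW => x _; apply: cvg_EFin; first exact: nearW.
    by apply: cvgM; [exact: cvg_cst|exact: gcvg].
  - exact: (@integrable01 _ (fun=> 4 * B) `|4 * B|).
  - by apply: aeW => x N _; rewrite /= lee_fin.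
suff E : (\int[leb]_(x in I01) (cosn k x * g x)%:E = (e k)%:E)%E.
  by rewrite /Rintegral E.
apply/esym; apply: cvg_unique lim => //.
apply: cvg_near_cst; exists k.+1 => // N /= kN.
have -> : (\int[leb]_(x in I01) (cosn k x * g_ N x)%:E)%E =
    (Rintegral leb I01 (fun x => cosn k x * g_ N x))%:E.
  rewrite fineK//; apply: integrable_fin_num => //.
  apply: (@integrable01 _ _ (4 * B)) => //.
  by apply: measurable_funM => //; exact: measurable_cosn.
rewrite gint (bigD1 (Ordinal kN))//= eqxx mulr1 big1 ?addr0// => i ik.
by move: ik; rewrite -val_eqE/= => /negbTE ->; rewrite mulr0.
Qed.

(** The measure [delta_0 + 3 * law(Theta)] has the atom; the correction restores
    the exact vanishing of the coefficients along [D]. *)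
Lemma not_vdC_of_summable (R : realType) (D : set nat) (Theta : R -> R) (B : R) :
  D `<=` [set n | (0 < n)%N] -> measurable_fun setT Theta ->
  (forall N, \sum_(h < N | `[< D h >])
    `|1 + 3 * Rintegral leb I01 (fun u => cosn h (Theta u))| <= B) ->
  ~ vdC_set R D.
Proof.
move=> D0 mT sB.
pose nu h := 1 + 3 * Rintegral leb I01 (fun u => cosn h (Theta u)).
pose e h : R := if `[< D h >] then - nu h else 0.
have eB N : \sum_(h < N) `|e h| <= B.
  apply: le_trans (sB N); rewrite [leRHS]big_mkcond; apply: ler_sum => h _.
  by rewrite /e; case: ifP; rewrite ?normrN ?normr0.
have [kappa [kappaoo kappaE]] := ex_cosine_correction eB.
have c3 (x : R) : 0 <= cst (3 : R) x <= 3 by rewrite /= lexx andbT.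
have [lam [lamoo lamE]] := ex_density01 (measurable_cst _) c3.
pose m2 : {measure set (measurableTypeR R) -> \bar R} := image_measure
  (mT : measurable_fun setT (Theta : measurableTypeR R -> measurableTypeR R)) lam.
have m2oo : (m2 setT < +oo)%E by rewrite /m2/= /image_measure /pushforward preimage_setT.
pose m12 : {measure set (measurableTypeR R) -> \bar R} :=
  measure_add (dirac (0%R : measurableTypeR R)) m2.
have m1oo : (dirac (0%R : measurableTypeR R) setT < +oo :> \bar R)%E by rewrite diracT ltry.
have m12E A : m12 A = (dirac (0%R : measurableTypeR R) A + m2 A)%E := measure_addE _ _ A.
have m12oo : (m12 setT < +oo)%E by rewrite m12E lte_add_pinfty.
pose tau : {measure set (measurableTypeR R) -> \bar R} := measure_add m12 kappa.
have tauE A : tau A = (m12 A + kappa A)%E := measure_addE _ _ A.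
apply: (@not_vdC_criterion R D tau).
- by rewrite tauE lte_add_pinfty.
- rewrite tauE; apply: (@lt_le_trans _ _ (m12 [set 0%R])); last by rewrite leeDl.
  rewrite m12E; apply: (@lt_le_trans _ _ 1%E); first exact: lte01.
  by rewrite diracE mem_set// leeDl.
move=> h Dh; have h0 : (0 < h)%N by exact: D0.
have mc := @measurable_cosn R h.
have c1 := @cosn_max R h.
rewrite (@Rintegral_measure_add _ _ _ m12 kappa (cosn h) 1)//.
rewrite (@Rintegral_measure_add _ _ _ _ m2 (cosn h) 1)//.
rewrite (kappaE _ h0) /e; case: asboolP => // _.
rewrite (@Rintegral_image _ _ _ _ _ _ _ _ _ 1)//.
rewrite (lamE _ 1); last 2 first.
- exact: (measurableT_comp mc).
- by move=> x; exact: c1.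
have -> : Rintegral (dirac (0%R : measurableTypeR R)) setT (cosn h) = 1.
  rewrite /Rintegral integral_dirac//; last exact/measurable_EFinP.
  by rewrite diracT mul1e/= /cosn !mulr0 cos0.
rewrite RintegralZr//; last first.
  apply: (@integrable01 _ _ 1); first exact: (measurableT_comp mc).
  by move=> x; exact: c1.
by rewrite /nu mulrC subrr.
Qed.

(** * The blocks and the random variable theta *)

Definition prime_at (l : nat) : nat := s2val (prime_above l.+2).

Lemma prime_atP l : [/\ prime (prime_at l), odd (prime_at l) & (l < prime_at l)%N].
Proof.
rewrite /prime_at; case: (prime_above l.+2) => p /= lp pp.
split => //; last by lia.
by case: (even_prime pp) => // p2; move: lp; rewrite p2.
Qed.

(** The 2-adic valuation takes every value infinitely often, so each prime of the
    list serves infinitely many blocks. *)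
Definition block_prime (k : nat) : nat := prime_at (logn 2 k.+1).

Definition width (k : nat) : nat := (3 * block_prime k)%N.

(** The exponents of consecutive powers in block [k] differ by [gap k].  Relative
    errors are of order [width k * 2 ^- gap k], and block [k] has at most
    [4 ^ width k] elements; the term [3 * width k] pays for both factors, [k]
    makes the blocks summable and [7] absorbs the numerical constants. *)
Definition gap (k : nat) : nat := (3 * width k + k + 7)%N.

Fixpoint base (k : nat) : nat :=
  if k is m.+1 then (base m + gap m * (width m).+1)%N else 0%N.

(** The [j]-th power of two of block [k] is [2 ^ expo k j]. *)
Definition expo (k j : nat) : nat := (base k + gap k * j)%N.

Lemma width_gt0 k : (0 < width k)%N.
Proof. by rewrite muln_gt0/=; case: (prime_atP (logn 2 k.+1)) => /prime_gt0. Qed.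

Lemma base_ltS k : (base k < base k.+1)%N.
Proof. by rewrite /= -addn1 leq_add2l muln_gt0 /gap; lia. Qed.

Lemma leq_base k m : (k <= m)%N -> (base k <= base m)%N.
Proof.
move=> /subnK <-; elim: (m - k)%N => // i IH.
by rewrite addSn (leq_trans IH)// ltnW// base_ltS.
Qed.

Lemma leq_id_base k : (k <= base k)%N.
Proof. by elim: k => // k IH; exact: (leq_ltn_trans IH (base_ltS k)). Qed.

Lemma expo_gap k i j : (i < j)%N -> (expo k i + gap k <= expo k j)%N.
Proof. by move=> ij; rewrite /expo -addnA leq_add2l addnC -mulnS leq_mul2l ij orbT. Qed.

Lemma expo_base k j : (j < width k)%N -> (expo k j + gap k <= base k.+1)%N.
Proof.
by move=> jn; rewrite /expo /= -addnA leq_add2l addnC -mulnS leq_mul2l (ltnW _) ?orbT.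
Qed.

(** For [u] uniform in the unit interval this index is uniform in block [k].  Only
    the index of its own block matters to a given [h], so a single [u] can drive all
    blocks at once. *)
Definition block_index (R : realType) (k : nat) (u : R) : nat :=
  Num.truncn ((width k)%:R * u).

Definition theta_term (R : realType) (k : nat) (u : R) : R :=
  2 ^- (expo k (block_index k u)).+1.

Definition theta_psum (R : realType) (N : nat) (u : R) : R := \sum_(k < N) theta_term k u.

Definition theta (R : realType) (u : R) : R := limn (fun N => theta_psum N u).

Lemma exp2_le (R : realType) m n : (m <= n)%N -> 2 ^- n <= 2 ^- m :> R.
Proof. by move=> mn; rewrite lef_pV2 ?posrE ?exprn_gt0// ler_weXn2l// ler1n. Qed.

Lemma theta_term_gt0 (R : realType) k (u : R) : 0 < theta_term k u.
Proof. by rewrite invr_gt0 exprn_gt0. Qed.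

Lemma theta_term_le (R : realType) k (u : R) : theta_term k u <= 2 ^- (base k).+1.
Proof. by apply: exp2_le; rewrite ltnS leq_addr. Qed.

(** Telescoping: [theta_term N u] is at most half of [2 ^- base N], and so is
    [2 ^- base N.+1]. *)
Lemma theta_psum_tail (R : realType) k N (u : R) : (k <= N)%N ->
  theta_psum N u + 2 ^- base N <= theta_psum k u + 2 ^- base k.
Proof.
move=> /subnK <-; elim: (N - k)%N => [//|m IH]; apply: le_trans IH.
rewrite addSn /theta_psum big_ord_recr/= -addrA lerD2l.
have h1 := theta_term_le (m + k) u.
have h2 := exp2_le R (base_ltS (m + k)).
rewrite [X in _ <= X](_ : _ = 2 ^- (base (m + k)).+1 + 2 ^- (base (m + k)).+1); first exact: lerD.
by rewrite exprS invfM -mulrDl; lra.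
Qed.

Lemma theta_psum_nd (R : realType) (u : R) : nondecreasing_seq (fun N => theta_psum N u).
Proof.
by apply/nondecreasing_seqP => N; rewrite /theta_psum big_ord_recr/= lerDl ltW// theta_term_gt0.
Qed.

Lemma theta_psum_le1 (R : realType) N (u : R) : theta_psum N u <= 1.
Proof.
have := @theta_psum_tail R 0 N u (leq0n _); rewrite /theta_psum big_ord0 add0r expr0 invr1.
by apply: le_trans; rewrite lerDl invr_ge0 exprn_ge0.
Qed.

Lemma theta_psum_cvg (R : realType) (u : R) : cvgn (fun N => theta_psum N u).
Proof.
apply: nondecreasing_is_cvgn; first exact: theta_psum_nd.
by exists 1 => _ [N _ <-]; exact: theta_psum_le1.
Qed.

Lemma theta_tail (R : realType) k (u : R) : 0 <= theta u - theta_psum k u <= 2 ^- base k.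
Proof.
rewrite subr_ge0 lerBlDl; apply/andP; split.
  apply: limr_ge; first exact: theta_psum_cvg.
  by exists k => // N kN; exact: theta_psum_nd.
apply: limr_le; first exact: theta_psum_cvg.
exists k => // N kN; apply: le_trans (theta_psum_tail u kN).
by rewrite lerDl invr_ge0 exprn_ge0.
Qed.

(** Larger [u] gives larger indices, hence smaller terms: [theta] is monotone. *)
Lemma measurable_theta (R : realType) : measurable_fun setT (@theta R).
Proof.
apply: nonincreasing_measurable => // x y xy.
apply: ler_lim; [exact: theta_psum_cvg..|apply: nearW => N].
apply: ler_sum => k _; apply: exp2_le; rewrite ltnS /expo leq_add2l leq_mul2l.
by rewrite le_truncn ?orbT// ler_wpM2l.
Qed.

(** * Multiples of theta modulo one *)

Definition near_int (R : realType) (x d : R) : Prop :=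
  exists2 z : R, z \is a Num.int & `|x - z| <= d.

Lemma near_intD (R : realType) (x y d e : R) :
  near_int x d -> near_int y e -> near_int (x + y) (d + e).
Proof.
move=> [a aZ xa] [b bZ yb]; exists (a + b); first exact: rpredD.
rewrite [X in `|X|](_ : _ = (x - a) + (y - b)); last by ring.
by rewrite (le_trans (ler_normD _ _))// lerD.
Qed.

Lemma near_intN (R : realType) (x d : R) : near_int x d -> near_int (- x) d.
Proof.
move=> [a aZ xa]; exists (- a); first by rewrite rpredN.
by rewrite -opprD normrN.
Qed.

Lemma near_int_sum (R : realType) (I : finType) (P : {set I}) (f : I -> R) (d : R) :
  (forall i, near_int (f i) d) -> near_int (\sum_(i in P) f i) (#|P|%:R * d).
Proof.
move=> fd; rewrite -sum1_card natr_sum mulr_suml.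
elim/big_rec2 : _ => [|i x y _ xy]; first by exists 0; rewrite ?rpred0 ?subrr ?normr0.
by rewrite mul1r; exact: near_intD.
Qed.

Lemma exp2_int (R : realType) m n : (m <= n)%N -> 2 ^+ n * 2 ^- m \is a (@Num.int R).
Proof.
by move=> mn; rewrite -expfB_cond ?pnatr_eq0//; apply: rpredX; exact: natr_int.
Qed.

Lemma block_index_lt (R : realType) k (u : R) : 0 <= u < 1 -> (block_index k u < width k)%N.
Proof.
move=> /andP[u0 u1]; rewrite truncn_lt_nat ?mulr_ge0//.
by rewrite gtr_pMr// ltr0n width_gt0.
Qed.

(** A single power of two times [theta]: the earlier blocks and the smaller exponents
    of the same block give integers, the equal exponent gives [1/2], the larger
    exponents of the same block and the later blocks give at most [2 ^- gap k]. *)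
Lemma expo_theta (R : realType) k j (u : R) : 0 <= u < 1 -> (j < width k)%N ->
  near_int (2 ^+ expo k j * theta u - (j == block_index k u)%:R / 2) (2 * 2 ^- gap k).
Proof.
move=> u01 jn; set i := block_index k u; set M := 2 ^+ expo k j.
have M0 : 0 <= M by exact: exprn_ge0.
have g0 : 0 <= 2 ^- gap k :> R by rewrite invr_ge0 exprn_ge0.
have -> : M * theta u - (j == i)%:R / 2 =
    (M * theta_psum k u + (M * theta_term k u - (j == i)%:R / 2)) +
    M * (theta u - theta_psum k.+1 u).
  by rewrite /theta_psum big_ord_recr/= -/(theta_psum k u); ring.
(* the errors of the three summands are 0, 2 ^- gap k and 2 ^- gap k *)
rewrite mulr2n mulrDl mul1r -[X in near_int _ (X + _)]add0r.
apply: near_intD; first apply: near_intD.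
- exists (M * theta_psum k u); last by rewrite subrr normr0.
  rewrite /theta_psum mulr_sumr; apply: rpred_sum => m _; apply: exp2_int.
  rewrite (@leq_trans (base k))// ?leq_addr// (leq_trans _ (leq_base (ltn_ord m)))//.
  apply: leq_trans (expo_base (block_index_lt m u01)).
  by rewrite -addn1 leq_add2l /gap; lia.
- rewrite /theta_term -/i; case: (ltngtP j i) => [ji|ij|ji].
  + exists 0; rewrite ?rpred0// mul0r !subr0 ger0_norm; last first.
      by rewrite mulr_ge0// invr_ge0 exprn_ge0.
    rewrite /M ler_pdivrMr ?exprn_gt0// ler_pdivlMl ?exprn_gt0// -exprD ler_weXn2l ?(ler1n R 2)//.
    by rewrite addnC ltnW// ltnS expo_gap.
  + exists (M * 2 ^- (expo k i).+1); last by rewrite mul0r subr0 subrr normr0.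
    apply: exp2_int; apply: leq_trans (expo_gap k ij); rewrite -addn1 leq_add2l.
    by rewrite /gap; lia.
  + exists 0; rewrite ?rpred0// /M ji exprS invfM mulrCA mulfV ?expf_neq0//.
    by rewrite mulr1 mul1r subrr subr0 normr0.
- exists 0; rewrite ?rpred0// subr0.
  have /andP[t0 t1] := theta_tail k.+1 u.
  rewrite ger0_norm ?mulr_ge0//; apply: (le_trans (ler_wpM2l M0 t1)).
  rewrite /M ler_pdivrMr ?exprn_gt0// ler_pdivlMl ?exprn_gt0// -exprD ler_weXn2l ?(ler1n R 2)//.
  by rewrite addnC expo_base.
Qed.

Lemma norm_sin_le (R : realType) (x : R) : `|sin x| <= `|x|.
Proof.
wlog x0 : x / 0 <= x => [H|].
  case: (leP 0 x) => [/H//|/ltW x0].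
  by rewrite -normrN -sinN -[leRHS]normrN H// oppr_ge0.
have [->|xn0] := eqVneq x 0; first by rewrite sin0.
have xp : 0 < x by rewrite lt_neqAle eq_sym xn0.
have cs : {within `[0, x], continuous (@sin R)}.
  by apply: continuous_subspaceT => y; exact: continuous_sin.
have [c _] := @MVT R sin cos 0 x xp (fun y _ => is_derive_sin y) cs.
by rewrite sin0 !subr0 => ->; rewrite normrM ler_piMl// cos_max.
Qed.

(** The constant [8] bounds [2 * pi], the Lipschitz constant of [cos (2 * pi * x)]. *)
Lemma cos_near_int (R : realType) (b : bool) (x d : R) :
  near_int (x - b%:R / 2) d -> `|cos (2 * pi * x) - (-1) ^+ b| <= 8 * d.
Proof.
have cos1 (y : R) : `|cos y - 1| <= `|y|.
  rewrite [X in cos X](_ : y = (y / 2) *+ 2); last by rewrite mulr2n; field.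
  rewrite cos_mulr2n cos2sin2 (_ : _ - 1 = - (sin (y / 2) ^+ 2 *+ 2)); last first.
    by rewrite !mulr2n; ring.
  rewrite normrN normrMn normrX -[leLHS]mulr_natr.
  have := norm_sin_le (y / 2); rewrite normrM [`|2^-1|]ger0_norm//.
  rewrite ler_pdivlMr//; apply: le_trans.
  by rewrite ler_pM2r// expr2 ler_piMr// sin_max.
have pi4 : pi <= 4 :> R by have := pihalf_lt2 R; lra.
move=> [z zZ xz]; set y := x - b%:R / 2 - z in xz.
have key : `|cos (2 * pi * y) - 1| <= 8 * d.
  apply: (le_trans (cos1 _)); rewrite !normrM.
  rewrite [`|2|]ger0_norm// [`|pi|]ger0_norm ?pi_ge0//.
  by apply: ler_pM => //; [rewrite mulr_ge0// pi_ge0|rewrite (_ : 8 = 2 * 4) ?ler_pM2l// -natrM].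
have -> : x = (y + b%:R / 2) + z by rewrite /y; ring.
rewrite cosDint//; case: b {xz} @y key => y key; last by rewrite mul0r addr0 expr0.
rewrite expr1 mul1r.
have -> : 2 * pi * (y + 2^-1) = 2 * pi * y + pi by field.
by rewrite cosDpi -opprD normrN.
Qed.

(** * Fourier coefficients along a block *)

Definition block_weight (k : nat) (S : {set 'I_(width k)}) : nat :=
  (\sum_(j in S) 2 ^ expo k j)%N.

Lemma block_weight_theta (R : realType) k (S : {set 'I_(width k)}) (u : R) (i : 'I_(width k)) :
  0 <= u < 1 -> block_index k u = i ->
  near_int ((block_weight S)%:R * theta u - (i \in S)%:R / 2) ((width k)%:R * (2 * 2 ^- gap k)).
Proof.
move=> u01 ui.
have := near_int_sum S (fun j : 'I_(width k) => expo_theta u01 (ltn_ord j)).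
have -> : \sum_(j in S) (2 ^+ expo k j * theta u - (j == block_index k u :> nat)%:R / 2) =
   (block_weight S)%:R * theta u - (i \in S)%:R / 2.
  rewrite sumrB -!mulr_suml /block_weight natr_sum; congr (_ * _ - _ / _).
    by apply: eq_bigr => j _; rewrite natrX.
  rewrite ui; case: (boolP (i \in S)) => iS.
    by rewrite (bigD1 i)//= eqxx big1 ?addr0// => j /andP[_]; rewrite -val_eqE => /negbTE->.
  rewrite big1// => j jS; rewrite val_eqE; case: eqVneq => // ji.
  by move: jS iS; rewrite ji => ->.
move=> [z zZ zle]; exists z => //; apply: le_trans zle _.
by rewrite ler_wpM2r ?mulr_ge0 ?invr_ge0 ?exprn_ge0// ler_nat (leq_trans (max_card _))// card_ord.
Qed.

Lemma cos_block (R : realType) k (S S' : {set 'I_(width k)}) (u : R) (i : 'I_(width k)) :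
  0 <= u < 1 -> block_index k u = i -> (block_weight S <= block_weight S')%N ->
  `|cosn (block_weight S' - block_weight S) (theta u) - (-1) ^+ ((i \in S) (+) (i \in S'))| <=
  32 * ((width k)%:R * 2 ^- gap k).
Proof.
move=> u01 ui SS'; rewrite /cosn.
have -> : 32 * ((width k)%:R * 2 ^- gap k) =
  8 * ((width k)%:R * (2 * 2 ^- gap k) + (width k)%:R * (2 * 2 ^- gap k)) :> R by ring.
apply: cos_near_int; rewrite natrB//.
have [z zZ zle] :=
  near_intD (block_weight_theta S' u01 ui) (near_intN (block_weight_theta S u01 ui)).
(* half the difference of the two indicators and half their exclusive or differ
   by an integer *)
exists (z - ((i \in S) && (i \notin S'))%:R); first by rewrite rpredB// natr_int.
move: zle; congr (`|_| <= _).
by case: (i \in S); case: (i \in S') => /=; field.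
Qed.

Definition cell (R : realType) (n i : nat) : set R :=
  [set` `[i%:R / n%:R, i.+1%:R / n%:R[%R].

Definition step_fun (R : realType) (n : nat) (c : 'I_n -> R) (u : R) : R :=
  \sum_(i < n) c i * \1_(cell n i) u.

(** Locates [u] in the partition of the unit interval into [width k] equal cells. *)
Lemma step_funE (R : realType) k (c : 'I_(width k) -> R) (u : R) (i : 'I_(width k)) :
  0 <= u -> block_index k u = i -> step_fun c u = c i.
Proof.
move=> u0 ui; have n0 : 0 < (width k)%:R :> R by rewrite ltr0n width_gt0.
have cellP (j : 'I_(width k)) : (u \in cell (width k) j) = (j == i).
  rewrite -val_eqE/= -ui [RHS]eq_sym truncn_eq ?mulr_ge0// /cell mem_setE in_itv/=.
  by rewrite ler_pdivrMr// ltr_pdivlMr// mulrC.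
rewrite /step_fun (bigD1 i)//= indicE cellP eqxx mulr1 big1 ?addr0// => j ji.
by rewrite indicE cellP (negbTE ji) mulr0.
Qed.

Lemma measurable_cell (R : realType) n i : measurable (cell n i : set R).
Proof. exact: measurable_itv. Qed.

Lemma leb_cell (R : realType) n i : (0 < n)%N ->
  @lebesgue_measure R (cell n i) = n%:R^-1%:E.
Proof.
move=> n0; rewrite lebesgue_measure_itv/= lte_fin ltr_pM2r ?invr_gt0 ?ltr0n//.
by rewrite ltr_nat ltnSn -EFinD -mulrBl -natr1 addrC addKr mul1r.
Qed.

Lemma integrable_cell (R : realType) n i (a : R) :
  leb.-integrable J01 (EFin \o (fun u => a * \1_(cell n i) u)).
Proof.
apply: (@bounded_integrable _ _ _ _ _ _ `|a|) => //.
- exact: leb_J01_lty.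
- by apply: measurable_funM => //; apply: measurable_indic; exact: measurable_cell.
- by move=> u; rewrite normrM ler_piMr// indicE; case: (_ \in _); rewrite ?normr1 ?normr0.
Qed.

Lemma Rintegral_cell (R : realType) n (i : 'I_n) (a : R) :
  Rintegral leb J01 (fun u => a * \1_(cell n i) u) = n%:R^-1 * a.
Proof.
have n0 : 0 < n%:R :> R by rewrite ltr0n (leq_ltn_trans (leq0n _) (ltn_ord i)).
rewrite RintegralZl//; last first.
  have := @integrable_cell R n i 1.
  by rewrite (_ : (fun u => 1 * _) = (fun u => \1_(cell n i) u))//;
    apply/funext => u; rewrite mul1r.
rewrite mulrC; congr (_ * _); rewrite /Rintegral integral_indic//; last exact: measurable_cell.
rewrite setIidl.
  by rewrite [X in fine X = _](_ : _ = n%:R^-1%:E)//; apply: leb_cell; rewrite -(ltr0n R).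
move=> x; rewrite /cell/= !in_itv/= => /andP[ix xi]; rewrite (le_trans _ ix) ?divr_ge0//=.
by rewrite (lt_le_trans xi)// ler_pdivrMr// mul1r ler_nat.
Qed.

Lemma integrable_step (R : realType) n (c : 'I_n -> R) :
  leb.-integrable J01 (EFin \o step_fun c).
Proof.
rewrite (_ : EFin \o _ =
    (fun u => \sum_(i < n) (EFin \o (fun v : R => (c i * \1_(cell n i) v)%R)) u)%E).
  by apply: integrable_sum => // i _; exact: integrable_cell.
by apply/funext => u; rewrite sumEFin.
Qed.

Lemma Rintegral_step (R : realType) n (c : 'I_n -> R) :
  Rintegral leb J01 (step_fun c) = n%:R^-1 * \sum_i c i.
Proof.
rewrite /Rintegral; apply: EFin_inj; rewrite fineK; last first.
  by apply: integrable_fin_num => //; exact: integrable_step.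
under eq_integral => x _ do rewrite -sumEFin.
rewrite integral_sum//; last by move=> i; exact: integrable_cell.
rewrite mulr_sumr -sumEFin; apply: eq_bigr => i _.
rewrite -(Rintegral_cell i) fineK//; apply: integrable_fin_num => //.
exact: integrable_cell.
Qed.

(** By [cos_block] the integrand is within the error of a step function taking the
    value [-1] on the [2 * p] cells of the symmetric difference and [1] on the other
    [p] cells, whose mean is [-1/3]. *)
Lemma block_coefficient (R : realType) k (S S' : {set 'I_(width k)}) :
  sdist S S' = (2 * block_prime k)%N -> (block_weight S <= block_weight S')%N ->
  `|1 + 3 * Rintegral leb I01 (fun u : R => cosn (block_weight S' - block_weight S) (theta u))|
    <= 96 * ((width k)%:R * 2 ^- gap k).
Proof.
move=> dSS' SS'; set h := (_ - _)%N.
pose c (i : 'I_(width k)) : R := (-1) ^+ ((i \in S) (+) (i \in S')).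
have n0 : (width k)%:R != 0 :> R by rewrite pnatr_eq0 -lt0n width_gt0.
have sumc : \sum_i c i = - ((width k)%:R / 3).
  have -> : \sum_i c i = \sum_(i : 'I_(width k)) (1 : R) - 2 * (sdist S S')%:R.
    have cE : #|S|%:R = \sum_i (i \in S)%:R :> R.
      by rewrite -sum1_card natr_sum big_mkcond; apply: eq_bigr => i _; case: ifP.
    rewrite sdistE cE mulrDr !mulr_sumr -big_split/= -sumrB.
    apply: eq_bigr => i _ /=; rewrite /c.
    by case: (i \in S); case: (i \in S') => /=; ring.
  have wE : (width k)%:R = 3 * (block_prime k)%:R :> R by rewrite -natrM.
  by rewrite sumr_const card_ord dSS' natrM wE; field.
have mf : measurable_fun setT (fun u : R => cosn h (theta u)).
  exact: (measurableT_comp (@measurable_cosn R h) (@measurable_theta R)).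
have intf : leb.-integrable J01 (EFin \o (fun u : R => cosn h (theta u))).
  have : leb.-integrable I01 (EFin \o (fun u : R => cosn h (theta u))).
    by apply: (@integrable01 _ _ 1) => // u; exact: cosn_max.
  by apply: integrableS => //; move=> x /=; rewrite !in_itv/= => /andP[-> /ltW].
have -> : Rintegral leb I01 (fun u : R => cosn h (theta u)) =
   Rintegral leb J01 (fun u : R => cosn h (theta u)).
  by rewrite -Rintegral_itv_bndo_bndc.
have -> : 1 + 3 * Rintegral leb J01 (fun u : R => cosn h (theta u)) =
    3 * (Rintegral leb J01 (fun u : R => cosn h (theta u)) - Rintegral leb J01 (step_fun c)).
  by rewrite Rintegral_step sumc; field.
rewrite -RintegralB//; last exact: integrable_step.
rewrite [leRHS](_ : _ = 3 * (32 * ((width k)%:R * 2 ^- gap k))); last by ring.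
rewrite normrM ger0_norm// ler_pM2l//.
have iB : leb.-integrable J01 (EFin \o (fun u : R => cosn h (theta u) - step_fun c u)).
  rewrite (_ : EFin \o _ = (fun u : R =>
    (EFin \o (fun v : R => cosn h (theta v))) u - (EFin \o step_fun c) u)%E)//.
  by apply: integrableB => //; exact: integrable_step.
apply: (le_trans (le_normr_Rintegral _ iB)) => //.
apply: (@le_trans _ _ (Rintegral leb J01 (fun=> 32 * ((width k)%:R * 2 ^- gap k)))).
  apply: le_Rintegral => //.
  - have := integrable_norm iB.
    by congr (leb.-integrable _ _).
  - apply: (@bounded_integrable _ _ _ _ _ _ `|32 * ((width k)%:R * 2 ^- gap k)|) => //.
    exact: leb_J01_lty.
  - move=> u /=; rewrite in_itv/= => u01.
    pose i := Ordinal (block_index_lt k u01).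
    rewrite (@step_funE _ _ _ _ i)//; last by case/andP: (u01).
    exact: cos_block.
rewrite Rintegral_cst//; rewrite [X in _ * fine X](_ : _ = 1%E) ?mulr1//.
exact: leb_J01.
Qed.

(** * The set and its properties *)

Definition block_difference k (q : {set 'I_(width k)} * {set 'I_(width k)}) (h : nat) :=
  [/\ sdist q.1 q.2 = (2 * block_prime k)%N, (block_weight q.1 < block_weight q.2)%N &
      h = (block_weight q.2 - block_weight q.1)%N].

Definition rec_set : set nat := [set h | exists k q, @block_difference k q h].

Lemma gap_bound (R : realType) k :
  96 * ((width k)%:R * 2 ^- gap k) <= 4 ^- width k * 2 ^- k :> R.
Proof.
have -> : 2 ^- gap k = 2 ^- width k * 4 ^- width k * 2 ^- k * 128^-1 :> R.
  rewrite /gap (exprD _ (3 * width k + k)) (exprD _ (3 * width k) k).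
  rewrite (exprM (2 : R) 3 (width k)) (_ : 2 ^+ 3 = 2 * 4); last by ring.
  by rewrite exprMn (_ : 2 ^+ 7 = 128) ?invfM//; ring.
have P0 : 0 <= 4 ^- width k * 2 ^- k :> R by rewrite mulr_ge0// invr_ge0 exprn_ge0.
have w2 : (width k)%:R * 2 ^- width k <= 1 :> R.
  by rewrite ler_pdivrMr ?exprn_gt0// mul1r -natrX ler_nat ltnW// ltn_expl.
have alg (a b c d : R) : 96 * (d * (a * b * c * 128^-1)) = (3 / 4 * (d * a)) * (b * c).
  by field.
rewrite alg ler_piMl//; lra.
Qed.

(** If the two sums were equal, the integrand of [block_coefficient] would be the
    constant [1], giving a coefficient [1 + 3 = 4], too large for that bound. *)
Lemma block_weight_neq (R : realType) k (S S' : {set 'I_(width k)}) :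
  sdist S S' = (2 * block_prime k)%N -> block_weight S <> block_weight S'.
Proof.
move=> d SS'; have := @block_coefficient R k S S' d; rewrite SS' leqnn subnn.
move=> /(_ isT); under eq_Rintegral => u _ do rewrite /cosn mul0r mulr0 cos0.
rewrite Rintegral_cst// [X in fine X](_ : _ = 1%E)//; last first.
  exact: leb_I01.
rewrite /= !mulr1 ger0_norm// => /le_trans/(_ (gap_bound R k)).
apply/negP; rewrite -ltNge; apply: (@le_lt_trans _ _ 1); last by lra.
by rewrite mulr_ile1 ?invr_ge0 ?exprn_ge0// invf_le1 ?exprn_gt0// exprn_ege1 ?(ler1n R).
Qed.

(** All powers of block [k] are multiples of [2 ^ base k], hence so is [h]. *)
Lemma block_difference_gt k q h : @block_difference k q h -> (k < h)%N.
Proof.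
case=> _ lt ->.
have dv S : (2 ^ base k %| @block_weight k S)%N.
  by apply: dvdn_sum => j _; apply: dvdn_exp2l; exact: leq_addr.
have pos : (0 < block_weight q.2 - block_weight q.1)%N by rewrite subn_gt0.
apply: leq_trans (dvdn_leq pos (dvdn_sub (dv _) (dv _))).
by apply: (leq_ltn_trans (leq_id_base k)); exact: ltn_expl.
Qed.

(** Each [h] below [N] comes from a block [k < N]; replace the sum over [h] by the sum
    over all pairs of index sets of these blocks.  Block [k] has [4 ^ width k] pairs,
    each contributing at most [4 ^- width k * 2 ^- k]. *)
Lemma summable_coefficients (R : realType) N :
  \sum_(h < N | `[< rec_set h >])
    `|1 + 3 * Rintegral leb I01 (fun u : R => cosn h (theta u))| <= 2.
Proof.
pose w k : R := 4 ^- width k * 2 ^- k.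
have w0 k : 0 <= w k by rewrite mulr_ge0// invr_ge0 exprn_ge0.
pose D k (q : {set 'I_(width k)} * {set 'I_(width k)}) (h : nat) : R :=
  (h == block_weight q.2 - block_weight q.1)%N%:R * w k.
have D0 k q h : 0 <= @D k q h by rewrite mulr_ge0.
apply: (@le_trans _ _ (\sum_(h < N) \sum_(k < N) \sum_q @D k q h)).
  rewrite big_mkcond; apply: ler_sum => h _; case: asboolP; last first.
    by move=> _; apply: sumr_ge0 => k _; exact: sumr_ge0.
  move=> [k [q kqh]]; have kh := block_difference_gt kqh.
  have kN : (k < N)%N := ltn_trans kh (ltn_ord h).
  apply: (@le_trans _ _ (@D k q h)).
    case: kqh => dq lq ->; rewrite /D eqxx mul1r.
    exact: le_trans (block_coefficient R dq (ltnW lq)) (gap_bound R k).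
  rewrite (bigD1 (Ordinal kN))//= (bigD1 q)//= -addrA lerDl addr_ge0//.
    exact: sumr_ge0.
  by apply: sumr_ge0 => j _; exact: sumr_ge0.
rewrite exchange_big/=.
apply: (@le_trans _ _ (\sum_(k < N) 2 ^- k)); last first.
  suff : \sum_(k < N) 2 ^- k + 2 * 2 ^- N <= 2 :> R.
    by apply: le_trans; rewrite lerDl mulr_ge0// invr_ge0 exprn_ge0.
  elim: N => [|N IH]; first by rewrite big_ord0 expr0; lra.
  by apply: le_trans IH; rewrite big_ord_recr/= exprS invfM; lra.
apply: ler_sum => k _; rewrite exchange_big/=.
apply: (@le_trans _ _ (\sum_(q : {set 'I_(width k)} * {set 'I_(width k)}) w k)).
  apply: ler_sum => q _; rewrite /D -mulr_suml ler_piMl//.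
  case: (ltnP (block_weight q.2 - block_weight q.1) N) => qN.
    rewrite (bigD1 (Ordinal qN))//= eqxx big1 ?addr0// => i.
    by rewrite -val_eqE/= => /negbTE ->.
  rewrite big1// => i _; case: eqP => // iq; have := ltn_ord i.
  by rewrite iq ltnNge qN.
rewrite sumr_const -[leLHS]mulr_natr.
rewrite card_prod -!cardsT -!powersetT !card_powerset !cardsT card_ord -expnMn.
by rewrite natrX /w mulrAC mulVf ?mul1r// expf_neq0.
Qed.

(** Apply [cube_pigeonhole] to the preimages of [A] at the times given by the sums over
    the index sets.  Invariance of [mu] turns the intersection at two times into
    the intersection of [A] with its preimage at the time difference. *)
Lemma block_recurrence (R : realType) d (X : measurableType d)
    (mu : probability X R) (T : X -> X) (A : set X) (a c : R) k :
  measure_preserving mu T -> measurable A -> (a%:E <= mu A)%E -> 0 <= c ->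
  (2 * #|[set S : {set 'I_(width k)} | (#|S| <= (block_prime k).-1)%N]%SET|)%:R +
    8 ^+ block_prime k * (64 ^+ block_prime k * c) < 8 ^+ block_prime k * a ->
  exists q h, @block_difference k q h /\ (c%:E < mu (A `&` iter h T @^-1` A))%E.
Proof.
move=> mp mA aA c0 big.
have [pp op _] := prime_atP (logn 2 k.+1).
apply: contrapT => none.
have mT := mp.1.
pose F (S : {set 'I_(width k)}) : set X := iter (block_weight S) T @^-1` A.
have mF S : measurable (F S).
  by rewrite -[X in measurable X]setTI; exact: measurable_iter.
have half S S' : sdist S S' = (2 * block_prime k)%N -> (block_weight S < block_weight S')%N ->
    (mu (F S `&` F S') <= c%:E)%E.
  move=> SS' lt; rewrite leNgt; apply/negP => cF; apply: none.
  exists (S, S'), (block_weight S' - block_weight S)%N; split => //.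
  rewrite -(measure_preserving_iter (block_weight S) mp); last first.
    apply: measurableI => //; rewrite -[X in measurable X]setTI; exact: measurable_iter.
  rewrite (_ : _ @^-1` _ = F S `&` F S')//.
  rewrite preimage_setI; congr (_ `&` _); rewrite -comp_preimage /F.
  by apply/seteqP; split => x; rewrite /preimage/= -iterD subnK// ltnW.
have := @cube_pigeonhole R d X mu (block_prime k) F a c pp op mF.
move=> /(_ _ _ c0); rewrite leNgt big/= => H; suff : False by []; apply: notF; apply: H.
- by move=> S; rewrite /F measure_preserving_iter.
- move=> S S' SS'.
  have := @block_weight_neq R k S S' SS'.
  case: (ltngtP (block_weight S) (block_weight S')) => // lt _.
    exact: half.
  by rewrite setIC; apply: half => //; rewrite -SS' /sdist addnC.
Qed.

(** The threshold has density at most [2 * (27 / 32) ^ p] in the cube of [8 ^ p] points. *)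
Lemma small_sets_negligible (R : realType) (a : R) : 0 < a ->
  exists L, forall p, (L <= p)%N -> (0 < p)%N ->
    (2 * #|[set S : {set 'I_(3 * p)} | (#|S| <= p.-1)%N]%SET|)%:R < 8 ^+ p * a.
Proof.
move=> a0; have r1 : `|27 / 32 : R| < 1 by rewrite ger0_norm//; lra.
have a2 : 0 < a / 2 by rewrite divr_gt0.
have /cvgrPdist_lt/(_ _ a2)[L _ HL] := cvg_expr r1.
exists L => p Lp p0; have := HL p Lp.
rewrite /= sub0r normrN ger0_norm ?exprn_ge0// => rp.
have V := card_small_sets p0; set v := #|_| in V *.
rewrite -(ltr_pM2r (_ : 0 < 4 ^+ p)) ?exprn_gt0// mulrAC -exprMn -natrX -natrM.
apply: (@le_lt_trans _ _ (2 * 27 ^+ p)).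
  by rewrite -natrX -natrM ler_nat -mulnA leq_mul2l V.
move: rp; rewrite expr_div_n ltr_pdivrMr ?exprn_gt0// (_ : 8 * 4%:R = 32) -?natrM//; lra.
Qed.

(** The prime is chosen from [mu A] alone, and the lower bound [c] from the prime and
    [mu A]; infinitely many blocks carry this prime, so [h] can be taken beyond any
    [N]. *)
Lemma rec_set_recurrence (R : realType) d (X : measurableType d)
    (mu : probability X R) (T : X -> X) (A : set X) :
  measure_preserving mu T -> measurable A -> (0 < mu A)%E ->
  exists2 c : R, 0 < c & forall N, exists h,
    [/\ (N <= h)%N, rec_set h & (c%:E < mu (A `&` iter h T @^-1` A))%E].
Proof.
move=> mp mA A0; pose a := fine (mu A).
have aE : mu A = a%:E by rewrite /a fineK// fin_num_measure.
have a0 : 0 < a by rewrite -lte_fin -aE.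
have [L HL] := small_sets_negligible (divr_gt0 a0 (ltr0n R 2)).
pose p := prime_at L; pose c := a / (4 * 64 ^+ p).
have c0 : 0 < c by rewrite divr_gt0// mulr_gt0// exprn_gt0.
(* an index k >= N such that the 2-adic valuation of k.+1 is L *)
exists c => // N; pose k := (2 ^ L * (2 * N).+1).-1.
have kS : k.+1 = (2 ^ L * (2 * N).+1)%N by rewrite prednK// muln_gt0 expn_gt0.
have lk : logn 2 k.+1 = L.
  rewrite kS lognM ?expn_gt0// pfactorK// logn_coprime ?addn0//.
  by rewrite coprime2n/= oddM.
have pk : block_prime k = p by rewrite /block_prime lk.
have Nk : (N <= k)%N.
  rewrite -ltnS kS (@leq_trans (2 * N).+1)//; first by lia.
  by rewrite leq_pmull// expn_gt0.
have [pp _ Lp] := prime_atP L.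
have big : (2 * #|[set S : {set 'I_(width k)} | (#|S| <= (block_prime k).-1)%N]%SET|)%:R +
    8 ^+ block_prime k * (64 ^+ block_prime k * c) < 8 ^+ block_prime k * a.
  rewrite /width pk.
  have := HL p (ltnW Lp) (prime_gt0 pp) => H.
  apply: (@lt_le_trans _ _ (8 ^+ p * (a / 2) + 8 ^+ p * (64 ^+ p * c))).
    by rewrite ltrD2r.
  rewrite -mulrDr ler_pM2l ?exprn_gt0// /c.
  have -> : 64 ^+ p * (a / (4 * 64 ^+ p)) = a / 4 by field; rewrite ?expf_neq0.
  lra.
have amu : (a%:E <= mu A)%E by rewrite aE.
have [q [h [qh ch]]] := block_recurrence mp mA amu (ltW c0) big.
exists h; split => //; last by exists k, q.
by rewrite (leq_trans Nk)// ltnW// (block_difference_gt qh).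
Qed.

Theorem theorem1p10 (R : realType) :
  exists D : set nat, strong_recurrence_set R D /\ ~ vdC_set R D.
Proof.
have pos : rec_set `<=` [set n | (0 < n)%N].
  by move=> h [k [q /block_difference_gt kh]]; exact: leq_ltn_trans kh.
exists rec_set; split; last first.
  by apply: (not_vdC_of_summable pos (@measurable_theta R)) => N; exact: summable_coefficients.
split=> // [|d X mu T mp A mA A0].
  (* infinite: the recurrence of the identity of a one-point mass already gives
     arbitrarily large elements *)
  move=> /finite_seqP[F FE].
  pose mu : probability (measurableTypeR R) R := dirac (0 : measurableTypeR R).
  have mpid : measure_preserving mu id by split; first exact: measurable_id.
  have muT : (0 < mu [set: measurableTypeR R])%E.
    by rewrite [X in (_ < X)%E](_ : _ = 1%E) ?lte01//; exact: probability_setT.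
  have [c _ /(_ (\max_(x <- F) x).+1)[h [Fh Dh _]]] := rec_set_recurrence mpid measurableT muT.
  move: Dh; rewrite FE => hF; move: Fh; rewrite ltnNge; apply/negP; rewrite negbK.
  exact: leq_bigmax_seq.
have [c c0 cN] := rec_set_recurrence mp mA A0.
apply: (@lt_le_trans _ _ c%:E); first by rewrite lte_fin.
rewrite limf_esupE; apply: le_ereal_inf_tmp => _ [V [N _ NV] <-].
have [h [Nh Dh ch]] := cN N.
apply: (le_trans (ltW ch)); apply: ereal_sup_ubound; exists h => //.
exact: NV.
Qed.
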